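(* Let $n$, $m$, $q$ be positive integers with $m<n$ and $q<n/m$, and let $f(0)>f(1)>\cdots>f(q)\ge 0$ be real numbers. Let $\lambda_1,\dots,\lambda_n$ be arbitrary nonzero complex numbers (not necessarily distinct). Then there exist a matrix $A\in\mathbb{C}^{n\times n}$ whose eigenvalues, counted with algebraic multiplicity, are $\lambda_1,\dots,\lambda_n$, and a vector $r_0\in\mathbb{C}^n$ with $\|r_0\|=f(0)$, such that $\|r_k\|=f(k)$ for $k=1,\dots,q$, where $r_k$ is the residual at cycle $k$ of restarted GMRES with restart parameter $m$ applied to the linear system $Ax=b$ with initial residual $r_0=b-Ax_0$.
   Context: $\|\cdot\|$ is the Euclidean norm on $\mathbb{C}^n$. For $A\in\mathbb{C}^{n\times n}$, $r\in\mathbb{C}^n$ and $j\ge 1$, the Krylov subspace is $\mathcal{K}_j(A,r)=\mathrm{span}\{r,Ar,\dots,A^{j-1}r\}$, and $A\mathcal{K}_j(A,r)=\mathrm{span}\{Ar,A^2r,\dots,A^jr\}$. Restarted GMRES with restart parameter $m$, GMRES($m$), applied to $Ax=b$ with initial approximation $x_0$ and initial residual $r_0=b-Ax_0$, produces at cycle $k=1,2,\dots$ an approximation $x_k\in x_{k-1}+\mathcal{K}_m(A,r_{k-1})$ whose residual $r_k=b-Ax_k$ has minimal norm; equivalently, $r_k=r_{k-1}-u_k$ where $u_k\in A\mathcal{K}_m(A,r_{k-1})$ and $\|r_k\|=\min_{u\in A\mathcal{K}_m(A,r_{k-1})}\|r_{k-1}-u\|$ (so $r_k$ is uniquely determined by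 $A$, $m$ and $r_{k-1}$). *)

(* Defs.v *)
From HB Require Import structures.
From mathcomp Require Import all_boot all_order all_algebra.
From mathcomp Require Import complex.
From mathcomp Require Import reals.

Set Implicit Arguments.
Unset Strict Implicit.
Unset Printing Implicit Defensive.

Import Order.TTheory GRing.Theory Num.Theory.

Local Open Scope ring_scope.

Section GMRES.

Variables (R : realType) (n : nat).
Local Notation C := R[i].
Implicit Types (A : 'M[C]_n) (b r v x y : 'cV[C]_n).

(* The library norm on matrices is a sup norm. [Normc.normc] is the modulus
   with values in [R]; the norm of the numeric domain [C] takes values in [C]. *)
Definition enorm v : R := Num.sqrt (\sum_(i < n) Normc.normc (v i 0) ^+ 2).

Definition krylov (j : nat) A r : {vspace 'cV[C]_n} :=
  <<[seq A ^+ i *m r | i <- iota 0 j]>>%VS.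

Definition residual A b x : 'cV[C]_n := b - A *m x.

Definition gmres_cycle (m : nat) A b x x' : Prop :=
  x' - x \in krylov m A (residual A b x) /\
  forall y, y - x \in krylov m A (residual A b x) ->
    enorm (residual A b x') <= enorm (residual A b y).

(* A relation rather than a function: for singular [A] the residuals are
   determined by the initial approximation but the approximations are not. *)
Definition restarted_gmres (m : nat) A b x0 (x : nat -> 'cV[C]_n) : Prop :=
  x 0%N = x0 /\ forall k, gmres_cycle m A b (x k) (x k.+1).

End GMRES.

(* Main.v *)
Require Import Defs.
From HB Require Import structures.
From mathcomp Require Import all_boot all_order all_algebra.
From mathcomp Require Import complex.
From mathcomp Require Import reals.
From mathcomp Require Import zify.

(** Fix real weights [a] and let [y_j] be the vector [(a_0, ..., a_(n-1))] with
the first [j] coordinates erased. The weighted shift [N] whose subdiagonal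
entries are the ratios [a_i / a_(i-1)] sends [y_j] to [y_(j+1)], and we take
[A = diag(lambda) (1 - N)]. This matrix is lower triangular with diagonal
[lambda], so its spectrum is the prescribed one whatever the weights, and
[[ A y_j = lambda_j (y_j - y_(j+1)) = lambda_j a_j e_j. ]]
Since the [lambda_j] are nonzero, this relation can be solved for [y_(j+1)], so
the Krylov space [K_m(A, y_s)] is spanned by [y_s, ..., y_(s+m-1)]. Its image
under [A] therefore lives on the coordinates [s, ..., s+m-1], where [y_(s+m)]
vanishes, while [y_s - y_(s+m)] belongs to that image. Hence [y_(s+m)] is the
minimal residual of a cycle started from [y_s], and GMRES([m]) started from
[y_0] has residual [y_(k m)] after [k] cycles ([gmres_chain]).

It remains to choose the weights. The squared norm of [y_j] is the sum of the
[a_i ^+ 2] for [j <= i], so any decreasing sequence [t] that reaches [0] at [n]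
is the norm profile of the [y_j] for [a_i = sqrt (t_i ^+ 2 - t_(i+1) ^+ 2)]
([enorm_tail]). Interpolating [f] linearly between the multiples of [m], and
dropping to [0] right after index [q * m < n], yields a profile with
[t_(k m) = f k] ([interpolate]). The weights before index [q * m] are positive
because [f] decreases strictly, so that the ratios defining [N] make sense; the
weight [a_(q m)] is [f q], possibly zero, and all later weights and ratios are
zero. *)

Set Implicit Arguments.
Unset Strict Implicit.
Unset Printing Implicit Defensive.

Import Order.TTheory GRing.Theory Num.Theory.

Local Open Scope ring_scope.
Local Open Scope complex_scope.

(** * Pythagoras for vectors with disjoint supports *)

Section Norm.

Variables (R : realType) (n : nat).
Implicit Types u v : 'cV[R[i]]_n.

Lemma sqr_enorm v : enorm v ^+ 2 = \sum_(i < n) Normc.normc (v i 0) ^+ 2.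
Proof. by rewrite sqr_sqrtr // sumr_ge0 // => i _; exact: sqr_ge0. Qed.

Lemma enorm_ge0 v : 0 <= enorm v.
Proof. exact: sqrtr_ge0. Qed.

Lemma sqr_enorm_eq0 v : enorm v ^+ 2 = 0 -> v = 0.
Proof.
rewrite sqr_enorm => /eqP; rewrite psumr_eq0 => [/allP v0 | i _]; last first.
  exact: sqr_ge0.
apply/matrixP => i j; rewrite ord1 mxE; apply: Normc.eq0_normc.
by have := v0 i (mem_index_enum i); rewrite sqrf_eq0 => /eqP.
Qed.

Lemma sqr_enormB_disjoint u v :
    (forall i, u i 0 = 0 \/ v i 0 = 0) ->
  enorm (u - v) ^+ 2 = enorm u ^+ 2 + enorm v ^+ 2.
Proof.
move=> uv0; rewrite !sqr_enorm -big_split; apply: eq_bigr => i _ /=.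
rewrite !mxE; case: (uv0 i) => ->.
  by rewrite sub0r normcN Normc.normc0 expr0n add0r.
by rewrite subr0 Normc.normc0 expr0n addr0.
Qed.

End Norm.

(** * Certifying the minimizer of one cycle *)

Section Cycle.

Variables (R : realType) (n m : nat) (A : 'M[R[i]]_n) (b : 'cV[R[i]]_n).

Lemma residualB x y : residual A b y = residual A b x - A *m (y - x).
Proof. by rewrite /residual mulmxBr opprB addrA subrK. Qed.

(** The usual optimality criterion asks the residual to be orthogonal to
[A *m z] for all [z] in the Krylov space. Here orthogonality always comes from
disjoint supports, which spares the inner product. By Pythagoras, a second
minimizer differs from [x'] by a vector that [A] kills, so its residual is the
same even where the minimizer itself is not unique. *)
Lemma gmres_cycle_of_disjoint x x' :
    let K := krylov m A (residual A b x) in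
    x' - x \in K ->
    (forall z, z \in K -> forall i, residual A b x' i 0 = 0 \/ (A *m z) i 0 = 0) ->
  gmres_cycle m A b x x' /\
  forall x'', gmres_cycle m A b x x'' -> residual A b x'' = residual A b x'.
Proof.
move=> K Kx' disj.
have pyth y : y - x \in K ->
    enorm (residual A b y) ^+ 2
    = enorm (residual A b x') ^+ 2 + enorm (A *m (y - x')) ^+ 2.
  move=> Ky; rewrite (residualB x') sqr_enormB_disjoint // => i.
  by apply: disj; rewrite -[y - x'](subrKA x) -(opprB x' x) rpredB.
split=> [|x'' [Kx'' minx'']].
  split=> // y Ky; rewrite -(@ler_pXn2r _ 2) ?nnegrE ?enorm_ge0 //.
  by rewrite (pyth _ Ky) lerDl sqr_ge0.
have := minx'' _ Kx'; rewrite -(@ler_pXn2r _ 2) ?nnegrE ?enorm_ge0 //.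
rewrite (pyth _ Kx'') gerDl => le0.
have /sqr_enorm_eq0 A0 : enorm (A *m (x'' - x')) ^+ 2 = 0.
  by apply/le_anti; rewrite le0 sqr_ge0.
by rewrite (residualB x') A0 subr0.
Qed.

End Cycle.

(** * Krylov spaces *)

Section Krylov.

Variables (R : realType) (n : nat) (A : 'M[R[i]]_n).
Implicit Types (r z : 'cV[R[i]]_n) (U : {vspace 'cV[R[i]]_n}).

Lemma mem_krylov i j r : (i < j)%N -> A ^+ i *m r \in krylov j A r.
Proof.
by move=> lt_ij; apply/memv_span/mapP; exists i; rewrite // mem_iota.
Qed.

Lemma krylov_subP j r U :
  (forall i, (i < j)%N -> A ^+ i *m r \in U) -> (krylov j A r <= U)%VS.
Proof.
move=> AU; apply/span_subvP => v s_v; case: (mapP s_v) => i.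
by rewrite mem_iota => /andP[_ lt_ij] ->; exact: AU.
Qed.

Lemma krylov_mono j k r : (j <= k)%N -> (krylov j A r <= krylov k A r)%VS.
Proof.
by move=> le_jk; apply: krylov_subP => i /leq_trans-/(_ _ le_jk)/mem_krylov.
Qed.

Lemma mulmx_krylov j r z : z \in krylov j A r -> A *m z \in krylov j.+1 A r.
Proof.
move=> Kz; have /subvP/(_ z Kz) :
    (krylov j A r <= linfun (mulmx A) @^-1: krylov j.+1 A r)%VS.
  apply: krylov_subP => i lt_ij.
  by rewrite -memv_preim lfunE /= mulmxA mulmxE -exprS mem_krylov.
by rewrite -memv_preim lfunE.
Qed.

End Krylov.

(** * GMRES along a chain of vectors *)

Section Chain.

Variables (R : realType) (n : nat) (A : 'M[R[i]]_n).
Variables (y : nat -> 'cV[R[i]]_n) (mu : nat -> R[i]).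
Hypothesis mu_neq0 : forall j, mu j != 0.
Hypothesis A_chain : forall j, A *m y j = mu j *: (y j - y j.+1).

Lemma chainS j : y j.+1 = y j - (mu j)^-1 *: (A *m y j).
Proof. by rewrite A_chain scalerA mulVf // scale1r subKr. Qed.

(** Each [y j.+1] is obtained from [y j] with a single application of [A]. *)
Lemma mem_krylov_chain s i j : (i < j)%N -> y (s + i) \in krylov j A (y s).
Proof.
move=> lt_ij; apply: (subvP (krylov_mono _ _ lt_ij)).
elim: i {lt_ij} => [|i IHi].
  by rewrite addn0 -[X in X \in _]mul1mx; exact: (@mem_krylov _ _ _ 0).
rewrite addnS chainS rpredB ?rpredZ ?mulmx_krylov //.
exact: (subvP (krylov_mono _ _ (leqnSn _))).
Qed.

Lemma krylov_chain_sub s j :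
  (krylov j A (y s) <= <<[seq y (s + l) | l <- iota 0 j]>>)%VS.
Proof.
pose S k := <<[seq y (s + l) | l <- iota 0 k]>>%VS.
have y_S l k : (l < k)%N -> y (s + l) \in S k.
  by move=> lt_lk; apply/memv_span/mapP; exists l; rewrite // mem_iota.
have S_sub k (U : {vspace _}) :
    (forall l, (l < k)%N -> y (s + l) \in U) -> (S k <= U)%VS.
  move=> yU; apply/span_subvP => v S_v; case: (mapP S_v) => l.
  by rewrite mem_iota => /andP[_ lt_lk] ->; exact: yU.
suff pow i : A ^+ i *m y s \in S i.+1.
  apply: krylov_subP => i lt_ij; apply: subvP (pow i); apply: S_sub => l lt_li.
  by apply: y_S; lia.
elim: i => [|i IHi].
  by rewrite expr0 mul1mx -[s in X in X \in _]addn0 y_S.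
have /subvP/(_ _ IHi) : (S i.+1 <= linfun (mulmx A) @^-1: S i.+2)%VS.
  apply: S_sub => l lt_li; rewrite -memv_preim lfunE /= A_chain rpredZ // -addnS.
  by rewrite rpredB // y_S //; lia.
by rewrite -memv_preim lfunE /= mulmxA mulmxE -exprS.
Qed.

Lemma krylov_chainE s j z : z \in krylov j A (y s) ->
  exists c : 'I_j -> R[i], z = \sum_(l < j) c l *: y (s + l).
Proof.
move=> /(subvP (krylov_chain_sub _ _)) S_z.
exists (fun l => coord (map_tuple (fun l => y (s + l)) (iota_tuple j 0)) l z).
rewrite {1}(@coord_span _ _ _ (map_tuple _ (iota_tuple j 0)) _ S_z).
by apply: eq_bigr => l _; rewrite (nth_map 0%N) ?size_iota // nth_iota.
Qed.

(* This is what makes the residual [y (s + m)] orthogonal to the image under [A]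
   of the Krylov space of [y s]: that image is spanned by increments. *)
Hypothesis chain_disjoint : forall j k i,
  (j < k)%N -> (y j - y j.+1) i 0 = 0 \/ y k i 0 = 0.

(** The correction is the preimage under [A] of [y s - y (s + m)], obtained by
telescoping the chain relation. *)
Definition chain_step m s x : 'cV[R[i]]_n :=
  x + \sum_(0 <= l < m) (mu (s + l))^-1 *: y (s + l).

Lemma residual_chain_step m b x s :
  residual A b x = y s -> residual A b (chain_step m s x) = y (s + m).
Proof.
move=> res_x; rewrite (residualB _ _ x) [_ - x]addrC addKr res_x mulmx_sumr.
under eq_bigr => l _.
  rewrite -scalemxAr A_chain scalerA mulVf // scale1r -addnS -opprB; over.
by rewrite sumrN telescope_sumr // addn0 opprK addrC subrK.
Qed.

Lemma gmres_chain_step m b x s : residual A b x = y s ->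
  gmres_cycle m A b x (chain_step m s x) /\
  forall x', gmres_cycle m A b x x' -> residual A b x' = y (s + m).
Proof.
move=> res_x; rewrite -(residual_chain_step m res_x).
apply: gmres_cycle_of_disjoint.
  rewrite [_ - x]addrC addKr res_x big_mkord; apply: memv_suml => l _.
  by rewrite rpredZ // mem_krylov_chain.
move=> z; rewrite res_x => /krylov_chainE[c ->] i.
rewrite (residual_chain_step m res_x).
case: (eqVneq (y (s + m) i 0) 0) => [-> | ynz]; [by left | right].
rewrite mulmx_sumr summxE big1 // => l _; rewrite -scalemxAr A_chain scalerA mxE.
have lt_lm : (s + l < s + m)%N by rewrite ltn_add2l.
have [-> | y0] := chain_disjoint i lt_lm; first by rewrite mulr0.
by rewrite y0 eqxx in ynz.
Qed.

(** The approximations are handled only through their residuals: those of an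
arbitrary run agree, cycle after cycle, with those of the explicit run built
from [chain_step]. *)
Lemma gmres_chain m b x0 : residual A b x0 = y 0 ->
  (exists x, restarted_gmres m A b x0 x) /\
  forall x, restarted_gmres m A b x0 x ->
    forall k, residual A b (x k) = y (k * m).
Proof.
move=> res_x0; split=> [|x [x_0 cyc_x]]; last first.
  elim=> [|k IHk]; first by rewrite x_0.
  have [_ uniq_res] := gmres_chain_step m IHk.
  by rewrite mulSn addnC; exact: uniq_res.
pose x k := iteri k (fun k => chain_step m (k * m)) x0.
have res_x k : residual A b (x k) = y (k * m).
  elim: k => [|k IHk] //.
  by rewrite /x iteriS mulSn addnC residual_chain_step.
exists x; split=> // k; rewrite /x iteriS.
by have [] := gmres_chain_step m (res_x k).
Qed.

End Chain.

(** * The weighted shift matrix *)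

Section WeightedShift.

Variables (R : realType) (n : nat) (lambda : 'I_n -> R[i]) (a : nat -> R).

Definition tail j : 'cV[R[i]]_n :=
  \col_i (if (j <= i)%N then (a i)%:C else 0).

(** The product [diag(lambda) (1 - N)], where [N] is the weighted shift with
[N y_j = y_(j+1)] for [y_j = tail j]. *)
Definition shift_mx : 'M[R[i]]_n :=
  \matrix_(i, j) (if i == j then lambda i
                  else if i == j.+1 :> nat then - (lambda i * (a i / a j)%:C)
                  else 0).

Lemma char_poly_shift_mx :
  char_poly shift_mx = \prod_(i < n) ('X - (lambda i)%:P).
Proof.
rewrite char_poly_trig; first by apply: eq_bigr => i _; rewrite mxE eqxx.
apply/is_trig_mxP => i j lt_ij; rewrite mxE -val_eqE /= !ltn_eqF //.
exact: ltnW.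
Qed.

Lemma tail_subS j i :
  (tail j - tail j.+1) i 0 = if j == i then (a i)%:C else 0.
Proof.
by rewrite !mxE; case: (ltngtP j i) => _; rewrite ?subrr ?subr0.
Qed.

(* The quotient [a j.+1 / a j] is [0] when [a j = 0]; the shift then still sends
   tails to tails provided that the weights stay zero once they vanish. *)
Hypothesis a_stop : forall j, a j = 0 -> a j.+1 = 0.

(** In row [i] the two entries contribute [lambda i * a i] and, as soon as
coordinate [i.-1] belongs to the tail as well, [- lambda i * a i]: only row
[j], the first one of the tail, survives the cancellation. *)
Lemma shift_mx_tail j i :
  (shift_mx *m tail j) i 0 = lambda i * (tail j - tail j.+1) i 0.
Proof.
rewrite tail_subS mxE (bigD1 i) //= !mxE eqxx.
case: (posnP i) => [i0 | i_gt0].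
  rewrite big1 ?addr0 => [|l l_i]; last first.
    by rewrite !mxE eq_sym (negPf l_i) i0 mul0r.
  by rewrite i0 leqn0; case: eqP.
have lt_i : (i.-1 < n)%N := leq_ltn_trans (leq_pred i) (ltn_ord i).
rewrite (bigD1 (Ordinal lt_i)) /=; last first.
  by rewrite -val_eqE /= neq_ltn prednK // leqnn.
rewrite big1 ?addr0 => [|l /andP[l_i l_i1]]; last first.
  rewrite !mxE eq_sym (negPf l_i) ifF ?mul0r //; apply/negP => /eqP i_l.
  by case/negP: l_i1; rewrite -val_eqE /= i_l.
rewrite !mxE -val_eqE /= gtn_eqF; last by rewrite prednK.
rewrite prednK // eqxx.
case: (ltngtP j i) => [lt_ji | lt_ij | ->].
- have -> : (j <= i.-1)%N by lia.
  have [a0 | a_neq0] := eqVneq (a i.-1) 0.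
    by rewrite -(prednK i_gt0) (a_stop a0) a0 mulr0 !mulr0 addr0.
  by rewrite mulNr -mulrA -rmorphM /= divfK // addrN mulr0.
- by rewrite leqNgt (leq_ltn_trans (leq_pred i)) //= !mulr0 addr0.
- have -> : (i <= i.-1)%N = false by lia.
  by rewrite mulr0 addr0.
Qed.

(** The indices [j >= n] of the chain carry zero tails, so [lambda] can be
extended there by any nonzero value; [1] is used. *)
Lemma gmres_shift_mx m b x0 :
    (forall i, lambda i != 0) -> residual shift_mx b x0 = tail 0 ->
  (exists x, restarted_gmres m shift_mx b x0 x) /\
  forall x, restarted_gmres m shift_mx b x0 x ->
    forall k, residual shift_mx b (x k) = tail (k * m).
Proof.
move=> lambda_neq0; pose mu j := oapp lambda 1 (insub j).
apply: (@gmres_chain _ _ _ _ mu) => [j | j | j k i lt_jk].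
- by rewrite /mu; case: insub => //=; exact: oner_neq0.
- apply/matrixP => i l; rewrite ord1 shift_mx_tail [RHS]mxE tail_subS.
  by case: eqP => [-> | _]; rewrite ?mulr0 // /mu valK.
- rewrite tail_subS mxE; case: eqP => [<- | _]; last by left.
  by right; rewrite leqNgt lt_jk.
Qed.

Lemma sqr_enorm_tail j :
  enorm (tail j) ^+ 2 = \sum_(i < n | (j <= i)%N) a i ^+ 2.
Proof.
rewrite sqr_enorm [RHS]big_mkcond; apply: eq_bigr => i _; rewrite mxE.
case: ifP => _; last by rewrite Normc.normc0 expr0n.
by rewrite /= expr0n addr0 sqr_sqrtr ?sqr_ge0.
Qed.

End WeightedShift.

(** * The choice of the weights *)

(** The squared weights telescope. *)
Lemma enorm_tail (R : realType) n (t : nat -> R) j :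
    (forall i, 0 <= t i) -> (forall i, t i.+1 <= t i) -> t n = 0 ->
    (j <= n)%N ->
  enorm (tail n (fun i => Num.sqrt (t i ^+ 2 - t i.+1 ^+ 2)) j) = t j.
Proof.
move=> t_ge0 t_decr tn0 le_jn; apply/eqP.
rewrite -(@eqrXn2 _ 2) ?enorm_ge0 // sqr_enorm_tail; apply/eqP.
rewrite -(@big_geq_mkord _ _ _ j n xpredT
  (fun i => Num.sqrt (t i ^+ 2 - t i.+1 ^+ 2) ^+ 2)).
under eq_bigr => i _.
  rewrite sqr_sqrtr ?subr_ge0 ?ler_pXn2r ?nnegrE // -opprB; over.
by rewrite sumrN telescope_sumr // opprB tn0 expr0n subr0.
Qed.

(** Between two multiples of [m] the interpolation is affine. Past [q * m] it must
be [0], not merely decreasing: the profile has to end at [0] at index [n],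
which may be as close as [q * m + 1]. *)
Lemma interpolate (R : realType) m q (f : nat -> R) :
    (0 < m)%N -> (forall k, (k < q)%N -> f k.+1 < f k) ->
  exists t : nat -> R,
    [/\ forall k, (k <= q)%N -> t (k * m)%N = f k,
        forall j, (j < q * m)%N -> t j.+1 < t j
      & forall j, (q * m < j)%N -> t j = 0].
Proof.
move=> m_gt0 f_decr.
pose t j := if (q * m < j)%N then 0 else
  f (j %/ m)%N - (j %% m)%:R / m%:R * (f (j %/ m)%N - f (j %/ m).+1).
exists t; split=> [k le_kq | j lt_j | j lt_j]; last by rewrite /t lt_j.
  rewrite /t ltn_mul2r m_gt0 ltnNge le_kq /= mulnK //.
  by rewrite modnMl !mul0r subr0.
rewrite /t ltnNge lt_j /= ltnNge ltnW //=.
have m_neq0 : m%:R != 0 :> R by rewrite pnatr_eq0 -lt0n.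
have lt_div : (j %/ m < q)%N by rewrite ltn_divLR.
(* The affine formula attached to the block of [j] also gives the right value at
   [j.+1] when [j] is the last index of its block. *)
have step : f (j.+1 %/ m)%N
    - (j.+1 %% m)%:R / m%:R * (f (j.+1 %/ m)%N - f (j.+1 %/ m).+1)
  = f (j %/ m)%N - (j %% m).+1%:R / m%:R * (f (j %/ m)%N - f (j %/ m).+1).
  have := ltn_pmod j m_gt0; rewrite leq_eqVlt => /orP[/eqP last_j | lt_jm].
    have -> : j.+1 = ((j %/ m).+1 * m)%N.
      by rewrite {1}(divn_eq j m) -addnS last_j mulSn addnC.
    by rewrite mulnK // modnMl last_j divff // !mul0r subr0 mul1r subKr.
  have -> : j.+1 = (j %/ m * m + (j %% m).+1)%N.
    by rewrite {1}(divn_eq j m) addnS.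
  by rewrite divnMDl // modnMDl (divn_small lt_jm) (modn_small lt_jm) addn0.
rewrite step ltrD2l ltrN2 ltr_pM2r ?subr_gt0 ?f_decr //.
by rewrite ltr_pM2r ?ltr_nat // invr_gt0 ltr0n.
Qed.

Theorem theorem2 (R : realType) (n m q : nat) (f : nat -> R)
    (lambda : 'I_n -> R[i])
    (n_gt0 : (0 < n)%N) (m_gt0 : (0 < m)%N) (q_gt0 : (0 < q)%N)
    (lt_mn : (m < n)%N) (lt_qnm : q%:R < n%:R / m%:R :> rat)
    (f_decr : forall k, (k < q)%N -> f k.+1 < f k) (fq_ge0 : 0 <= f q)
    (lambda_neq0 : forall i, lambda i != 0) :
  exists (A : 'M[R[i]]_n) (r0 : 'cV[R[i]]_n),
    [/\ char_poly A = \prod_(i < n) ('X - (lambda i)%:P),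
        enorm r0 = f 0%N
      & forall b x0 : 'cV[R[i]]_n, residual A b x0 = r0 ->
          (exists x : nat -> 'cV[R[i]]_n, restarted_gmres m A b x0 x) /\
          (forall x : nat -> 'cV[R[i]]_n, restarted_gmres m A b x0 x ->
             forall k, (1 <= k <= q)%N -> enorm (residual A b (x k)) = f k)].
Proof.
have lt_qm : (q * m < n)%N.
  by move: lt_qnm; rewrite ltr_pdivlMr ?ltr0n // -natrM ltr_nat.
have [t [t_f t_decr t_0]] := interpolate m_gt0 f_decr.
have t_qm : 0 <= t (q * m)%N by rewrite t_f.
have le_t j : t j.+1 <= t j.
  have [lt_j | lt_j | ->] := ltngtP j (q * m)%N; first exact/ltW/t_decr.
    by rewrite !t_0 // ltnW.
  by rewrite (t_0 _ (ltnSn _)).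
have t_ge0 j : 0 <= t j.
  have [le_j | lt_j] := leqP j (q * m); last by rewrite t_0.
  apply: le_trans t_qm _; elim: (q * m)%N le_j => [|p IHp].
    by rewrite leqn0 => /eqP->.
  by rewrite leq_eqVlt => /orP[/eqP-> // | /IHp]; exact: le_trans.
pose a j := Num.sqrt (t j ^+ 2 - t j.+1 ^+ 2).
(* A zero weight can occur only from index [q * m] on: at [q * m] itself if
   [f q = 0], and at all later indices. *)
have a_stop j : a j = 0 -> a j.+1 = 0.
  have [lt_j | le_j] := ltnP j (q * m).
    move/eqP; rewrite sqrtr_eq0 subr_le0 ler_pXn2r ?nnegrE // leNgt.
    by rewrite t_decr.
  by move=> _; rewrite /a !t_0 ?subrr ?sqrtr0 // ltnW.
have norm_tail k : (k <= q)%N -> enorm (tail n a (k * m)) = f k.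
  move=> le_kq; rewrite enorm_tail ?t_f ?t_0 //.
  by apply: leq_trans (ltnW lt_qm); rewrite leq_mul2r le_kq orbT.
exists (shift_mx lambda a), (tail n a 0); split.
- exact: char_poly_shift_mx.
- exact: (norm_tail 0).
- move=> b x0 /(gmres_shift_mx a_stop m lambda_neq0)[ex_x res_x].
  by split=> // x /res_x res_xk k /andP[_ le_kq]; rewrite res_xk norm_tail.
Qed.
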